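(* Let $P$ be a countable right LCM semigroup which is decomposed as an internal Zappa-Szép product $P=U\bowtie A$, and suppose that the following conditions hold: (C1) $U$ and $A$ are right LCM; (C2) $\mathcal{J}(A)$ is totally ordered by inclusion; (C3) the map $u\mapsto a\cdot u$ is a bijection $U\to U$ for each $a\in A$. Then the following pairs of $C^*$-algebras are isomorphic: (1) $C^*_A(U\bowtie A)$ and $C^*_{A}(\mathcal{S}_P)$; (2) $C^*_U(U\bowtie A)$ and $C^*_{U}(\mathcal{S}_P)$.
   Context: Right LCM semigroups. A semigroup $P$ with identity $1_P$ is right LCM if it is left cancellative and the intersection of any two principal right ideals is either empty or a principal right ideal. $\mathcal{J}(P)$ is the set of all principal right ideals $pP$ together with $\varnothing$. A finite subset $F\subset P$ is a foundation set if for all $p\in P$ there is $f\in F$ with $fP\cap pP\ne\varnothing$. Left inverse hull. Let $U(P)$ be the group of invertible elements of $P$. On $P\times P$ put $(p,q)\sim(a,b)$ iff there is $u\in U(P)$ with $p=au$, $q=bu$; $[p,q]$ is the class of $(p,q)$. $\mathcal{S}_P=\{[p,q]:p,q\in P\}\cup\{0\}$ is an inverse semigroup with zero $0$ and identity $[1_P,1_P]$, with $[a,b][c,d]=[ab',dc']$ if $bP\cap cP=rP$ and $bb'=cc'=r$, $[a,b][c,d]=0$ if $bP\cap cP=\varnothing$, and $[p,q]^{-1}=[q,p]$. Its non-zero idempotents are the elements $[p,p]$, and $[p,p]\le[q,q]$ iff $pP\subseteq qP$. $E(\mathcal{S}_P)$ is the semilattice of idempotents and $\mathcal{P}_{fin}(E)$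 denotes the set of finite subsets of $E$. Internal Zappa-Szép product. $P=U\bowtie A$ means that $U,A\subseteq P$ are subsemigroups with $U\cap A=\{1_P\}$ such that every $p\in P$ is uniquely $p=ua$ with $u\in U$, $a\in A$. For $u\in U,a\in A$ write $au=(a\cdot u)\,a|_u$ with $a\cdot u\in U$, $a|_u\in A$. The $C^*$-algebras of $P$. $C^*(P)$ is the universal $C^*$-algebra generated by isometries $\{v_p:p\in P\}$ and projections $\{e_X:X\in\mathcal{J}(P)\}$ subject to: $v_pv_q=v_{pq}$; $v_pe_Xv_p^*=e_{pX}$; $e_P=1$, $e_\varnothing=0$; $e_Xe_Y=e_{X\cap Y}$ (for all $p,q\in P$, $X,Y\in\mathcal{J}(P)$). $C^*_A(U\bowtie A)$ (additive boundary quotient) is the quotient of $C^*(P)$ by the relations $e_{aP}=1$ for all $a\in A$. $C^*_U(U\bowtie A)$ (multiplicative boundary quotient) is the quotient of $C^*(P)$ by the relations $\prod_{f\in F}(1-e_{fP})=0$ for all foundation sets $F\subseteq U$ of the semigroup $U$. Representations in $C^*$-algebras. A representation of an inverse semigroup $S$ with zero in a $C^*$-algebra $D$ is a map $\sigma\colon S\to D$ with $\sigma(0)=0$, $\sigma(st)=\sigma(s)\sigma(t)$, $\sigma(s^{-1})=\sigma(s)^*$. Let $D_\sigma$ be the $C^*$-subalgebra generated by $\sigma(E(S))$ and $B_\sigma=\{e\in D_\sigma:e^2=e\}$, a (generalized) Boolean algebra with $a\wedge b=ab$, $a\vee b=a+b-ab$, $a\setminus b=a-ab$. For $X\subseteq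 E(S)\times\mathcal{P}_{fin}(E(S))$, $\sigma$ is $X$-to-join if $\sigma|_{E(S)}\colon E(S)\to B_\sigma$ is proper (each element of $B_\sigma$ is below a finite join of elements of $\sigma(E(S))$) and $\sigma(e)=\bigvee_{i=1}^n\sigma(e_i)$ for all $(e,\{e_1,\dots,e_n\})\in X$. The $C^*$-algebras of $\mathcal{S}_P$. Let $X_A$ be the set of all $([a,a],\{[b,b]\})$ with $a\in A$ and $b\in aA$. Let $X_U$ be the set of all $([s,s],\{[s_1,s_1],\dots,[s_n,s_n]\})$ with $s\in U$, $s_i\in sU$ for all $i\in\{1,\dots,n\}$, and such that for each $t\in sU$ there is $i\in\{1,\dots,n\}$ with $s_iU\cap tU\ne\varnothing$. $C^*_A(\mathcal{S}_P)$ (respectively $C^*_U(\mathcal{S}_P)$) is the universal $C^*$-algebra generated by one element for each element of $\mathcal{S}_P$ subject to the relations saying that the standard map from $\mathcal{S}_P$ to it is an $X_A$-to-join (respectively $X_U$-to-join) representation. *)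

(* Defs.v *)
From HB Require Import structures.
From mathcomp Require Import all_boot all_order all_algebra finmap.
From mathcomp Require Import all_classical all_reals all_analysis.
From mathcomp Require Import complex.

Set Implicit Arguments.
Unset Strict Implicit.
Unset Printing Implicit Defensive.

Import Order.TTheory GRing.Theory Num.Theory.
Import numFieldNormedType.Exports.
Local Open Scope classical_set_scope.
Local Open Scope quotient_scope.
Local Open Scope ring_scope.
Local Open Scope group_scope.

Section RightLCM.
Variable P : monoidType.
Implicit Types (M U A : set P) (F : {fset P}).

(* The notions below are relative to a submonoid M of P; those for P itself
   are obtained with M = [set: P]. *)

Definition rideal M (p : P) : set P := [set p * m | m in M].

Definition principal_ideals M : set (set P) :=
  [set X | X = set0 \/ exists2 p, M p & X = rideal M p].

Definition right_LCM M : Prop :=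
  (forall p x y, M p -> M x -> M y -> p * x = p * y -> x = y) /\
  (forall p q, M p -> M q -> principal_ideals M (rideal M p `&` rideal M q)).

Definition foundation_set M F : Prop :=
  [set` F] `<=` M /\
  (forall p, M p -> exists2 f, f \in F & rideal M f `&` rideal M p !=set0).

Definition subsemigroup M : Prop := forall x y, M x -> M y -> M (x * y).

Definition zs_factors U A (p : P) : set (P * P) :=
  [set ua | [/\ U ua.1, A ua.2 & p = ua.1 * ua.2]].

Definition zappa_szep U A : Prop :=
  [/\ subsemigroup U, subsemigroup A, U `&` A = [set 1] &
      forall p, exists! ua, zs_factors U A p ua].

(* a · u, the U-component of au; the default value (1, 1) is never used when
   zappa_szep U A holds. *)
Definition zs_act U A (a u : P) : P := (xget (1, 1) (zs_factors U A (a * u))).1.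

Definition invertible (u : P) : Prop := exists v, u * v = 1 /\ v * u = 1.

End RightLCM.

HB.mixin Record isInverseSemigroup0 S of Semigroup S := {
  szero : S;
  sinv : S -> S;
  smul0s : forall s : S, szero * s = szero;
  smuls0 : forall s : S, s * szero = szero;
  smulsVs : forall s : S, s * sinv s * s = s;
  smulVsV : forall s : S, sinv s * s * sinv s = sinv s;
  sinv_unique : forall s t : S, s * t * s = s -> t * s * t = t -> t = sinv s
}.

#[short(type="inverseSemigroup0Type")]
HB.structure Definition InverseSemigroup0 :=
  {S of isInverseSemigroup0 S & Semigroup S}.

Definition idempotents (S : magmaType) : set S := [set e | e * e = e].

Section HullRelation.
Variable P : monoidType.
Implicit Types (p q a b c d : P) (z : P * P).

Definition hull_rel : rel (P * P) := fun x y : P * P =>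
  `[< exists u, [/\ invertible u, x.1 = y.1 * u & x.2 = y.2 * u] >].

Lemma hull_rel_refl : reflexive hull_rel.
Proof.
by move=> x; apply/asboolP; exists 1; rewrite !mulg1; split=> //; exists 1;
  rewrite !mulg1.
Qed.

Lemma hull_rel_sym : symmetric hull_rel.
Proof.
suff H x y : hull_rel x y -> hull_rel y x by move=> x y; apply/idP/idP; apply: H.
move=> /asboolP[u [[v [uv vu]] e1 e2]]; apply/asboolP; exists v.
by rewrite e1 e2 -!mulgA uv !mulg1; split=> //; exists u.
Qed.

Lemma hull_rel_trans : transitive hull_rel.
Proof.
move=> y x z /asboolP[u [[u' [uu' u'u]] e1 e2]] /asboolP[v [[v' [vv' v'v]] f1 f2]].
apply/asboolP; exists (v * u); rewrite e1 e2 f1 f2 !mulgA; split=> //.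
exists (u' * v'); split.
  by rewrite mulgA -(mulgA v) uu' mulg1.
by rewrite mulgA -(mulgA u') v'v mulg1.
Qed.

Canonical hull_equiv :=
  EquivRel hull_rel hull_rel_refl hull_rel_sym hull_rel_trans.

Definition hull_class := {eq_quot hull_equiv}.
HB.instance Definition _ := Choice.on hull_class.
HB.instance Definition _ := EqQuotient.on hull_class.

Definition hull_pair p q : hull_class := \pi_hull_class (p, q).

Lemma hull_pairP p q a b :
  hull_pair p q = hull_pair a b <->
  exists u, [/\ invertible u, p = a * u & q = b * u].
Proof.
split=> [/eqmodP/asboolP//|H].
by apply/eqmodP/asboolP.
Qed.

Lemma hull_reprK (x : hull_class) : hull_pair (repr x).1 (repr x).2 = x.
Proof. by rewrite /hull_pair -surjective_pairing reprK. Qed.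

(* z = (b', c') with bP ∩ cP = rP and bb' = cc' = r. *)
Definition lcm_cofactors b c z : Prop :=
  rideal setT b `&` rideal setT c = rideal setT (b * z.1) /\ b * z.1 = c * z.2.

(* The zero of the hull is None; representatives of the two classes and
   cofactors are chosen arbitrarily, see [hull_mulE] and [hull_mul0]. *)
Definition hull_mul (s t : option hull_class) : option hull_class :=
  if s isn't Some x then None else if t isn't Some y then None else
  let: (a, b) := repr x in let: (c, d) := repr y in
  if pselect (exists z, lcm_cofactors b c z) is left h then
    let z := projT1 (cid h) in Some (hull_pair (a * z.1) (d * z.2))
  else None.

Definition hull_inv (s : option hull_class) : option hull_class :=
  if s isn't Some x then None else Some (hull_pair (repr x).2 (repr x).1).

(* [p, q] acts as the partial injection qx |-> px; its graph determines it. *)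
Let graph (s : option hull_class) : P -> P -> Prop := fun y x =>
  if s isn't Some c then False
  else exists w, y = (repr c).2 * w /\ x = (repr c).1 * w.

Let graphE p q (y x : P) :
  graph (Some (hull_pair p q)) y x <-> exists w, y = q * w /\ x = p * w.
Proof.
have := hull_reprK (hull_pair p q); rewrite /graph; case: (repr _) => a b /=.
move=> /hull_pairP[u [[v [uv vu]] -> ->]]; split=> -[w [-> ->]].
  by exists (u * w); rewrite !mulgA.
by exists (v * w); rewrite !mulgA -!(mulgA _ u v) uv !mulg1.
Qed.

Hypothesis hP : right_LCM [set: P].

Let lcancel (p x y : P) : p * x = p * y -> x = y.
Proof. exact: hP.1. Qed.

Let lcm_ex b c w1 w2 : b * w1 = c * w2 -> exists z, lcm_cofactors b c z.
Proof.
move=> e; have [E|[r _ E]] := hP.2 b c I I.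
  by exfalso; have : (set0 : set P) (b * w1) by rewrite -E; split; [exists w1|exists w2].
have : rideal setT r r by exists 1 => //; rewrite mulg1.
by rewrite -E => -[[b' _ e1] [c' _ e2]]; exists (b', c'); rewrite /lcm_cofactors /= e1 e2.
Qed.

Let lcm_factor b c z w1 w2 : lcm_cofactors b c z -> b * w1 = c * w2 ->
  exists w, w1 = z.1 * w /\ w2 = z.2 * w.
Proof.
move=> [E e] e12; have : rideal setT (b * z.1) (b * w1).
  by rewrite -E; split; [exists w1|exists w2].
move=> [w _ ew]; exists w; split.
  by apply: (@lcancel b); rewrite mulgA ew.
by apply: (@lcancel c); rewrite mulgA -e ew.
Qed.

Let graph_inj_le p q a b :
  (forall y x : P, graph (Some (hull_pair p q)) y x ->
               graph (Some (hull_pair a b)) y x) ->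
  exists2 u, p = a * u & q = b * u.
Proof.
move=> H; have /graphE[u [-> ->]] : graph (Some (hull_pair a b)) q p.
  by apply/H/graphE; exists 1; rewrite !mulg1.
by exists u.
Qed.

Let graph_inj s t : (forall y x : P, graph s y x <-> graph t y x) -> s = t.
Proof.
case: s => [s|]; case: t => [t|] //= H; last 2 first.
- by have [+ _] := H (repr s).2 (repr s).1; case; exists 1; rewrite !mulg1.
- by have [_ +] := H (repr t).2 (repr t).1; case; exists 1; rewrite !mulg1.
congr Some; move: H; rewrite -(hull_reprK s) -(hull_reprK t).
move: (repr s) (repr t) => [p q] [a b] /= H.
have [u ep eq] : exists2 u, p = a * u & q = b * u.
  by apply: graph_inj_le => y x /H.
have [v ea eb] : exists2 v, a = p * v & b = q * v.
  by apply: graph_inj_le => y x /H.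
apply/hull_pairP; exists u; split=> //; exists v; split.
  by apply: (@lcancel a); rewrite mulgA -ep -ea mulg1.
by apply: (@lcancel p); rewrite mulgA -ea -ep mulg1.
Qed.

Let graph_mul s t (y x : P) :
  graph (hull_mul s t) y x <-> exists2 w, graph t y w & graph s w x.
Proof.
case: s => [s|]; last by split=> // -[].
case: t => [t|]; last by split=> // -[].
rewrite /hull_mul; case es: (repr s) => [a b]; case et: (repr t) => [c d].
case: pselect => [h|nh].
  move: (projT2 (cid h)); set z := projT1 _ => hz; rewrite graphE.
  split=> [[w [-> ->]]|[v]].
    exists (c * (z.2 * w)) => /=; rewrite ?es ?et /=.
      by exists (z.2 * w); rewrite !mulgA.
    by exists (z.1 * w); rewrite !mulgA hz.2.
  move=> /=; rewrite es et /= => -[w2 [-> ->]] [w1 [e ->]].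
  have [w [-> ->]] := lcm_factor hz (esym e).
  by exists w; rewrite !mulgA.
split=> // -[v] /=; rewrite es et /= => -[w2 [_ ->]] [w1 [e _]].
by apply: nh; apply: (lcm_ex (esym e)).
Qed.

Let graph_inv s (y x : P) : graph (hull_inv s) y x <-> graph s x y.
Proof.
case: s => [s|] //; rewrite /hull_inv graphE /=.
by split=> -[w [-> ->]]; exists w.
Qed.

Let graph_fun s (y x x' : P) : graph s y x -> graph s y x' -> x = x'.
Proof.
by case: s => [s|] //= [w [-> ->]] [w' [/lcancel -> ->]].
Qed.

Let graph_cofun s (y y' x : P) : graph s y x -> graph s y' x -> y = y'.
Proof.
by case: s => [s|] //= [w [-> ->]] [w' [-> /lcancel ->]].
Qed.

Lemma hull_mulE a b c d z : lcm_cofactors b c z ->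
  hull_mul (Some (hull_pair a b)) (Some (hull_pair c d)) =
  Some (hull_pair (a * z.1) (d * z.2)).
Proof.
move=> hz; apply: graph_inj => y x; rewrite graph_mul graphE.
split=> [[v /graphE[w2 [-> ->]] /graphE[w1 [e ->]]]|[w [-> ->]]].
  have [w [-> ->]] := lcm_factor hz (esym e).
  by exists w; rewrite !mulgA.
exists (c * (z.2 * w)); apply/graphE.
  by exists (z.2 * w); rewrite !mulgA.
by exists (z.1 * w); rewrite !mulgA hz.2.
Qed.

Lemma hull_mul0 a b c d : rideal setT b `&` rideal setT c = set0 ->
  hull_mul (Some (hull_pair a b)) (Some (hull_pair c d)) = None.
Proof.
move=> E; apply: graph_inj => y x; rewrite graph_mul; split=> //.
move=> [v /graphE[w2 [_ ->]] /graphE[w1 [e _]]].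
have : (set0 : set P) (c * w2) by rewrite -E; split; [exists w1|exists w2].
by [].
Qed.

Lemma hull_invE p q : hull_inv (Some (hull_pair p q)) = Some (hull_pair q p).
Proof.
by apply: graph_inj => y x; rewrite graph_inv !graphE;
  split=> -[w [-> ->]]; exists w.
Qed.

Lemma hull_mulA : associative hull_mul.
Proof.
move=> s t r; apply: graph_inj => y x; rewrite !graph_mul.
split=> [[v /graph_mul[w ? ?] ?]|[v ? /graph_mul[w ? ?]]].
  by exists w => //; apply/graph_mul; exists v.
by exists w => //; apply/graph_mul; exists v.
Qed.

Lemma hull_mul0s s : hull_mul None s = None. Proof. by []. Qed.

Lemma hull_muls0 s : hull_mul s None = None. Proof. by case: s. Qed.

Lemma hull_mulsVs s : hull_mul (hull_mul s (hull_inv s)) s = s.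
Proof.
apply: graph_inj => y x; rewrite graph_mul; split=> [[v yv]|yx].
  move=> /graph_mul[w /graph_inv wv wx].
  by rewrite (graph_cofun yv wv).
by exists x => //; apply/graph_mul; exists y => //; apply/graph_inv.
Qed.

Lemma hull_invK : involutive hull_inv.
Proof. by move=> s; apply: graph_inj => y x; rewrite !graph_inv. Qed.

Lemma hull_mulVsV s : hull_mul (hull_mul (hull_inv s) s) (hull_inv s) = hull_inv s.
Proof. by rewrite -{2}(hull_invK s) hull_mulsVs. Qed.

Lemma hull_inv_unique s t :
  hull_mul (hull_mul s t) s = s -> hull_mul (hull_mul t s) t = t ->
  t = hull_inv s.
Proof.
move=> e1 e2; apply: graph_inj => y x; rewrite graph_inv; split=> [yx|xy].
  have := yx; rewrite -{1}e2 => /graph_mul[w yw /graph_mul[w' ww' w'x]].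
  by rewrite (graph_fun yx yw) (graph_cofun yx w'x).
have := xy; rewrite -{1}e1 => /graph_mul[w xw /graph_mul[w' ww' w'y]].
by rewrite (graph_fun xy xw) (graph_cofun xy w'y).
Qed.

End HullRelation.

Definition left_inverse_hull (P : monoidType) (hP : right_LCM [set: P]) : Type :=
  option (hull_class P).

Section HullStructure.
Variables (P : monoidType) (hP : right_LCM [set: P]).
Local Notation S := (left_inverse_hull hP).

HB.instance Definition _ := Choice.copy S (option (hull_class P)).
HB.instance Definition _ := isSemigroup.Build S (hull_mulA hP).
HB.instance Definition _ := isInverseSemigroup0.Build S
  (@hull_mul0s P) (@hull_muls0 P) (hull_mulsVs hP) (hull_mulVsV hP)
  (hull_inv_unique hP).

(* The element [p, q] of the hull. *)
Definition hull_elt (p q : P) : S := Some (hull_pair p q).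

End HullStructure.

Local Close Scope group_scope.

(* C*-algebras are not assumed to be unital, whereas all ring structures of the
   library are: multiplication is that of the underlying semigroupType. The norm
   takes its values in R[i], where [<=] compares only numbers with the same
   imaginary part. *)
Notation "x ** y" := (x * y)%g (at level 40, left associativity) : ring_scope.

HB.mixin Record isCStarAlgebra (R : realType) D
    of CompleteNormedModule R[i] D & Semigroup D := {
  star : D -> D;
  cmulDl : forall x y z : D, (x + y) ** z = x ** z + y ** z;
  cmulDr : forall x y z : D, x ** (y + z) = x ** y + x ** z;
  cmulZl : forall (a : R[i]) (x y : D), (a *: x) ** y = a *: (x ** y);
  cmulZr : forall (a : R[i]) (x y : D), x ** (a *: y) = a *: (x ** y);
  starD : forall x y : D, star (x + y) = star x + star y;
  starZ : forall (a : R[i]) (x : D), star (a *: x) = a^* *: star x;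
  starM : forall x y : D, star (x ** y) = star y ** star x;
  starK : forall x : D, star (star x) = x;
  cnormM : forall x y : D, `|x ** y| <= `|x| * `|y|;
  cstar_identity : forall x : D, `|star x ** x| = `|x| ^+ 2
}.

#[short(type="cstarType")]
HB.structure Definition CStarAlgebra (R : realType) :=
  {D of isCStarAlgebra R D & CompleteNormedModule R[i] D & Semigroup D}.

Section CStar.
Variable R : realType.
Implicit Types C D : cstarType R.

Definition is_one D (u : D) : Prop := forall x : D, u ** x = x /\ x ** u = x.

Definition projection D (x : D) : Prop := star x = x /\ x ** x = x.

Definition star_hom C D (phi : C -> D) : Prop :=
  [/\ linear phi,
      {morph phi : x y / x ** y} &
      {morph phi : x / star x}].

Definition cstar_isomorphic C D : Prop :=
  exists2 phi : C -> D, star_hom phi & bijective phi.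

Definition cstar_subalgebra D (B : set D) : Prop :=
  [/\ B 0,
      forall (a : R[i]) x y, B x -> B y -> B (a *: x + y),
      forall x y, B x -> B y -> B (x ** y),
      forall x, B x -> B (star x) &
      closed B].

Definition cstar_generated D (G : set D) : set D := smallest (@cstar_subalgebra D) G.

Definition closed_ideal D (I : set D) : Prop :=
  [/\ I 0,
      forall (a : R[i]) x y, I x -> I y -> I (a *: x + y),
      forall x y, I x -> I (y ** x) /\ I (x ** y) &
      closed I].

(* C is the universal C*-algebra generated by the family g subject to the
   relations rel. Relations may force C to be unital (see [lcm_relations]), in
   which case the homomorphisms phi below are automatically unital. *)
Definition universal_cstar (G : Type) (rel : forall D, (G -> D) -> Prop)
    C (g : G -> C) : Prop :=
  [/\ rel C g,
      cstar_generated (range g) = setT &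
      forall D (h : G -> D), rel D h ->
        exists! phi : C -> D, star_hom phi /\ forall x, phi (g x) = h x].

(* pi exhibits Q as the quotient of C by the relations x = 0, for x in rels. *)
Definition cstar_quotient C (rels : set C) (Q : cstarType R) (pi : C -> Q) : Prop :=
  [/\ star_hom pi,
      range pi = setT &
      forall x, pi x = 0 <-> smallest (@closed_ideal C) rels x].

End CStar.

Section SemigroupAlgebra.
Variables (R : realType) (P : monoidType).

Definition constructible_ideal : Type := {X : set P | principal_ideals setT X}.
Local Notation J := constructible_ideal.

Lemma principal_ideals_rideal (p : P) : principal_ideals setT (rideal setT p).
Proof. by right; exists p. Qed.

Definition pideal (p : P) : J := exist _ (rideal setT p) (principal_ideals_rideal p).

(* The existential says that D is unital; translates and intersections of
   constructible ideals are named by Y and Z. *)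
Definition lcm_relations (D : cstarType R) (v : P -> D) (e : J -> D) : Prop :=
  exists2 one : D, is_one one &
  [/\ forall p, star (v p) ** v p = one,
      forall X, projection (e X),
      forall p q, v p ** v q = v (p * q)%g,
      forall p X Y, sval Y = [set (p * x)%g | x in sval X] ->
        v p ** e X ** star (v p) = e Y &
      [/\ forall X, sval X = setT -> e X = one,
          forall X, sval X = set0 -> e X = 0 &
          forall X Y Z, sval Z = sval X `&` sval Y -> e X ** e Y = e Z]].

(* g (inl p) = v_p and g (inr X) = e_X. *)
Definition is_cstar_semigroup (C : cstarType R) (g : P + J -> C) : Prop :=
  universal_cstar
    (fun D (h : P + J -> D) => lcm_relations (h \o inl) (h \o inr)) g.

Definition additive_relators (A : set P) (C : cstarType R) (e : J -> C) : set C :=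
  [set x | exists2 one, is_one one &
    exists2 a, A a & x = e (pideal a) - one].

Definition multiplicative_relators (U : set P) (C : cstarType R) (e : J -> C) :
    set C :=
  [set x | exists2 one, is_one one &
    exists2 F : {fset P}, foundation_set U F &
      x = \big[*%g/one]_(f <- F) (one - e (pideal f))].

Definition is_additive_boundary_quotient (A : set P) (Q : cstarType R) : Prop :=
  exists (C : cstarType R) (g : P + J -> C) (pi : C -> Q),
    is_cstar_semigroup g /\ cstar_quotient (additive_relators A (g \o inr)) pi.

Definition is_multiplicative_boundary_quotient (U : set P) (Q : cstarType R) :
    Prop :=
  exists (C : cstarType R) (g : P + J -> C) (pi : C -> Q),
    is_cstar_semigroup g /\
    cstar_quotient (multiplicative_relators U (g \o inr)) pi.

End SemigroupAlgebra.

Section ToJoin.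
Variables (R : realType) (S : inverseSemigroup0Type).
Implicit Types (D : cstarType R) (X : set (S * {fset S})).

Definition representation D (sigma : S -> D) : Prop :=
  [/\ sigma szero = 0,
      {morph sigma : s t / s ** t} &
      forall s, sigma (sinv s) = star (sigma s)].

(* The Boolean algebra B_sigma: its meet is [**], its join [cjoin] and its order
   [cle]. *)
Definition idempotent_algebra D (sigma : S -> D) : set D :=
  cstar_generated (sigma @` @idempotents S) `&` @idempotents D.

Definition cjoin D (a b : D) : D := a + b - a ** b.

Definition cle D (a b : D) : Prop := a ** b = a.

Definition fjoin D (sigma : S -> D) (F : {fset S}) : D :=
  \big[@cjoin D/0]_(s <- F) sigma s.

Definition proper_rep D (sigma : S -> D) : Prop :=
  forall b, idempotent_algebra sigma b ->
    exists2 F : {fset S}, [set` F] `<=` @idempotents S & cle b (fjoin sigma F).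

Definition to_join X D (sigma : S -> D) : Prop :=
  [/\ representation sigma, proper_rep sigma &
      forall e F, X (e, F) -> sigma e = fjoin sigma F].

Definition is_to_join_algebra X (B : cstarType R) : Prop :=
  exists sigma : S -> B, universal_cstar (@to_join X) sigma.

End ToJoin.

Section HullAlgebra.
Variables (P : monoidType) (hP : right_LCM [set: P]).
Local Notation S := (left_inverse_hull hP).
Local Notation idem p := (hull_elt hP p p).

Definition X_A (A : set P) : set (S * {fset S}) :=
  [set x | exists a b, [/\ A a, rideal A a b &
    x = (idem a, [fset idem b]%fset)]].

Definition X_U (U : set P) : set (S * {fset S}) :=
  [set x | exists s (F : {fset P}),
    [/\ U s,
        [set` F] `<=` rideal U s,
        forall t, rideal U s t ->
          exists2 f, f \in F & rideal U f `&` rideal U t !=set0 &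
        x = (idem s, [fset idem f | f in F]%fset)]].

End HullAlgebra.

Arguments X_A {P} hP A.
Arguments X_U {P} hP U.

(* Main.v *)
Require Import Defs.
From HB Require Import structures.
From mathcomp Require Import all_boot all_order all_algebra finmap.
From mathcomp Require Import all_classical all_reals all_analysis.
From mathcomp Require Import complex.
Local Open Scope classical_set_scope.

Set Implicit Arguments.
Unset Strict Implicit.
Unset Printing Implicit Defensive.

Import Order.TTheory GRing.Theory Num.Theory.
Import numFieldNormedType.Exports.
Local Open Scope ring_scope.

(** Each of the four algebras is given by generators and relations, and the two
presentations in a pair translate into each other. The hull element [p, q] goes
to v_p star(v_q) in one direction; in the other v_p is the image of [p, 1] and
the projection of the ideal pP is the image of the idempotent [p, p]. The range
projection v_p star(v_p) is the projection of pP, so the product rule of the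
hull, which computes the intersection of bP and cP, is the rule that makes
star(v_b) v_c either 0 or v_b' star(v_c') ([hull_map_rep],
[generators_map_relations]).

The remaining relations match because in a unital algebra the join of commuting
projections e_i equals 1 exactly when the product of the 1 - e_i vanishes. For A
this is immediate. For U, the multiplicative quotient only speaks about covers
of the whole of U by foundation sets, whereas X_U speaks about covers of every
right ideal sU; conjugation by v_s turns the former into the latter
([hull_map_X_U]). Unitality makes properness automatic
([unital_rep_proper]), and the algebra of the hull is unital because [1, 1] is an
identity for a generating set ([hull_rep_unital]).

Universality then gives a homomorphism from the algebra of the hull to the
boundary quotient, and one from the full semigroup algebra to the algebra of the
hull which kills the boundary relators. For the latter to factor through the
quotient, its kernel has to be a closed ideal, which means that star-homomorphisms
have to be continuous ([star_hom_bounded]). No spectral theory is used for that: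
if h is selfadjoint and small, a fixed point argument produces a selfadjoint g
commuting with h such that h^2 + (1 - g)^2 = 1, i.e. h is the real part of a
unitary of the unitization; a star-homomorphism preserves this algebraic relation,
and the C*-identity bounds the image of h. The two homomorphisms between the
quotients are mutually inverse since they are so on generators. *)

(** * Closed sets and fixed points in complex normed modules *)

Section Continuity.
Variable R : realType.

Lemma exp_half_lt (e : R[i]) : 0 < e -> exists n, (2^-1 : R[i]) ^+ n < e.
Proof.
case: e => a b; rewrite ltcE /= => /andP[/eqP -> a0].
have [n _ /(_ n (leqnn n)) /=] := near_infty_natSinv_expn_lt (PosNum a0).
rewrite div1r -exprVn -ltcR => h; exists n; move: h.
by rewrite rmorphXn /= fmorphV rmorph_nat.
Qed.

(** Additivity suffices, so that this also applies to the conjugate-linear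
involution of a C*-algebra. *)
Lemma bounded_kernel_closed (V W : normedModType R[i]) (f : V -> W) (M : R[i]) :
    {morph f : x y / x - y} -> 0 < M -> (forall x, `|f x| <= M * `|x|) ->
  closed [set x | f x = 0].
Proof.
move=> fB M0 fM x clx; apply/eqP; rewrite -normr_le0.
apply/ler_addgt0Pr => e e0; rewrite add0r.
have [|y [/= y0 /=]] := clx (ball x (e / M)).
  by apply: nbhsx_ballx; rewrite divr_gt0.
rewrite -ball_normE /= => /ltW xy.
have -> : f x = f (x - y) by rewrite fB y0 subr0.
by apply: (le_trans (fM _)); rewrite mulrC -ler_pdivlMr.
Qed.

Lemma norm_le_closed (V : normedModType R[i]) (r : R[i]) :
  closed [set x : V | `|x| <= r].
Proof.
move=> x clx; apply/ler_addgt0Pr => e e0.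
have [|y [/= yr /=]] := clx (ball x e); first exact: nbhsx_ballx.
rewrite -ball_normE /= => /ltW xy.
by rewrite -[x](subrK y) addrC (le_trans (ler_normD _ _)) // lerD.
Qed.

(** The contraction principle for norms with values in R[i]: the iterates satisfy
|f^(n+k) x0 - f^n x0| <= 2^-n |f^k x0 - x0|, and the second factor is bounded
on K. *)
Lemma half_contraction_fixpoint (V : completeNormedModType R[i]) (K : set V)
    (f : V -> V) (M : R[i]) (x0 : V) :
    closed K -> K x0 -> (forall x, K x -> K (f x)) ->
    (forall x y, K x -> K y -> `|f x - f y| <= 2^-1 * `|x - y|) ->
    (forall x y, K x -> K y -> `|x - y| < M) ->
  exists2 x, K x & x = f x.
Proof.
move=> clK Kx0 fK fc bK; pose u n := iter n f x0.
have Ku n : K (u n) by elim: n => //= n; exact: fK.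
have M0 : 0 < M by rewrite (le_lt_trans _ (bK _ _ Kx0 Kx0)).
have uc n k : `|u (n + k)%N - u n| <= 2^-1 ^+ n * M.
  elim: n => [|n ih]; first by rewrite expr0 mul1r add0n ltW // bK.
  by rewrite addSn (le_trans (fc _ _ _ _)) // exprS -mulrA ler_pM2l.
have small e : 0 < e -> exists n, 2^-1 ^+ n * M < e.
  move=> e0; have [|n] := exp_half_lt (e := e / M); first exact: divr_gt0.
  by exists n; rewrite -ltr_pdivlMr.
have cu : cvg (u @ \oo).
  apply/cauchy_cvgP/cauchy_exP => e /small[n hn].
  exists (u n), n => // m /= nm; rewrite -ball_normE /= distrC.
  by rewrite -(subnKC nm) (le_lt_trans (uc _ _)).
have Kl : K (limn u) by apply: closed_cvg cu => //; exact: nearW.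
exists (limn u) => //; apply/eqP; rewrite -subr_eq0 -normr_le0.
apply/ler_addgt0Pr => e e0; rewrite add0r.
have e2 : 0 < e / 2 by rewrite divr_gt0.
move/cvgrPdist_lt: cu => /(_ _ e2)[n _ hn].
have /= h1 := hn n.+1 (leqnSn n); have /= h2 := hn n (leqnn n).
rewrite -(subrKA (u n.+1)) (le_trans (ler_normD _ _)) // [leRHS]splitr.
rewrite lerD ?(ltW h1) // distrC (le_trans (fc _ _ _ _)) //.
rewrite (le_trans _ (ltW h2)) // ler_piMl // invf_le1 ?ler1n //.
Qed.
End Continuity.

(** * Continuity of star-homomorphisms *)

Section CStarBasics.
Variable R : realType.
Implicit Types C D : cstarType R.

Lemma cmul0l D (x : D) : 0 ** x = 0.
Proof. by apply: (addIr (0 ** x)); rewrite -cmulDl !add0r. Qed.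

Lemma cmul0r D (x : D) : x ** 0 = 0.
Proof. by apply: (addIr (x ** 0)); rewrite -cmulDr !add0r. Qed.

Lemma cmulNl D (x y : D) : (- x) ** y = - (x ** y).
Proof. by apply: (addIr (x ** y)); rewrite -cmulDl !addNr cmul0l. Qed.

Lemma cmulNr D (x y : D) : x ** (- y) = - (x ** y).
Proof. by apply: (addIr (x ** y)); rewrite -cmulDr !addNr cmul0r. Qed.

Lemma cmulBl D (x y z : D) : (x - y) ** z = x ** z - y ** z.
Proof. by rewrite cmulDl cmulNl. Qed.

Lemma cmulBr D (x y z : D) : x ** (y - z) = x ** y - x ** z.
Proof. by rewrite cmulDr cmulNr. Qed.

Lemma star0 D : star (0 : D) = 0.
Proof. by rewrite -[in LHS](scale0r (0 : D)) starZ conjC0 scale0r. Qed.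

Lemma starN D (x : D) : star (- x) = - star x.
Proof. by apply: (addIr (star x)); rewrite -starD !addNr star0. Qed.

Lemma starB D (x y : D) : star (x - y) = star x - star y.
Proof. by rewrite starD starN. Qed.

Lemma norm_star D (x : D) : `|star x| = `|x|.
Proof.
have le (y : D) : `|y| <= `|star y|.
  have [->|y0] := eqVneq y 0; first by rewrite star0.
  have ny : 0 < `|y| by rewrite normr_gt0.
  by rewrite -(ler_pM2r ny) -expr2 -cstar_identity cnormM.
by apply/le_anti; rewrite le andbT -{2}[x]starK le.
Qed.

Section StarHom.
Variables (C D : cstarType R) (phi : C -> D).
Hypothesis hphi : star_hom phi.

Lemma star_homD : {morph phi : x y / x + y}.
Proof. by case: hphi => lp _ _ x y; rewrite -[x]scale1r lp !scale1r. Qed.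

Lemma star_hom0 : phi 0 = 0.
Proof. by apply: (addIr (phi 0)); rewrite -star_homD !add0r. Qed.

Lemma star_homZ a x : phi (a *: x) = a *: phi x.
Proof. by case: hphi => lp _ _; rewrite -[a *: x]addr0 lp star_hom0 addr0. Qed.

Lemma star_homB : {morph phi : x y / x - y}.
Proof. by move=> x y; rewrite star_homD -scaleN1r star_homZ scaleN1r. Qed.

Lemma star_homM : {morph phi : x y / x ** y}. Proof. by case: hphi. Qed.

Lemma star_homS : {morph phi : x / star x}. Proof. by case: hphi. Qed.

End StarHom.

(** The solution g is 1 - sqrt (1 - h^2), written without a unit. It is the fixed
point of g |-> (h^2 + g^2) / 2, which maps the ball of radius 1/2 to itself and
is a contraction there; the selfadjoint elements commuting with h form a closed
invariant subset. *)
Lemma selfadjoint_square_root C (h : C) : star h = h -> `|h| <= 2^-1 ->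
  exists g : C, [/\ star g = g, h ** g = g ** h & h ** h + g ** g = 2 *: g].
Proof.
move=> sh nh.
pose K := [set g : C | star g - g = 0] `&` [set g | h ** g - g ** h = 0]
          `&` [set g | `|g| <= 2^-1].
pose f (g : C) : C := 2^-1 *: (h ** h + g ** g).
have half0 : 0 <= 2^-1 :> R[i] by rewrite invr_ge0.
have sq (x : C) : `|x| <= 2^-1 -> `|x ** x| <= 2^-1 * 2^-1.
  by move=> nx; apply: le_trans (cnormM _ _) _; rewrite ler_pM.
have clK : closed K.
  apply: closedI; last exact: norm_le_closed; apply: closedI.
    apply: (@bounded_kernel_closed _ C C (fun g => star g - g) 2) => //.
      by move=> x y; rewrite starB !opprD !opprK addrACA.
    move=> x; apply: le_trans (ler_normB _ _) _.
    by rewrite norm_star mulr_natl.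
  apply: (@bounded_kernel_closed _ C C (fun g => h ** g - g ** h) 1) => //.
    by move=> x y; rewrite cmulBr cmulBl !opprD !opprK addrACA.
  move=> x; apply: le_trans (ler_normB _ _) _.
  rewrite [1 * _](_ : _ = 2^-1 * `|x| + `|x| * 2^-1); last first.
    by rewrite mul1r [2^-1 * _]mulrC -splitr.
  rewrite lerD // (le_trans (cnormM _ _)) // ?ler_wpM2l ?ler_wpM2r //.
have fK g : K g -> K (f g).
  move=> [[/= /subr0_eq gs /subr0_eq gh] ng]; rewrite /f; split; [split|] => /=.
  - apply/eqP; rewrite subr_eq0 starZ starD !starM sh gs.
    by rewrite geC0_conj.
  - apply/eqP; rewrite subr_eq0 cmulZl cmulZr cmulDl cmulDr.
    by rewrite !mulgA gh -!mulgA gh !mulgA.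
  - rewrite normrZ ger0_norm // ler_piMr //.
    apply: le_trans (ler_normD _ _) _.
    apply: le_trans (lerD (sq _ nh) (sq _ ng)) _.
    by rewrite -splitr invf_le1 ?ler1n.
have fc x y : K x -> K y -> `|f x - f y| <= 2^-1 * `|x - y|.
  move=> [_ /= nx] [_ /= ny]; rewrite -scalerBr normrZ ger0_norm //.
  rewrite ler_wpM2l // opprD addrACA subrr add0r.
  have -> : x ** x - y ** y = x ** (x - y) + (x - y) ** y.
    by rewrite cmulBr cmulBl subrKA.
  apply: le_trans (ler_normD _ _) _.
  rewrite [leRHS](_ : _ = 2^-1 * `|x - y| + `|x - y| * 2^-1); last first.
    by rewrite [2^-1 * _]mulrC -splitr.
  by rewrite lerD // (le_trans (cnormM _ _)) // ?ler_wpM2l ?ler_wpM2r.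
have K0 : K 0.
  by split; [split|]; rewrite /= ?star0 ?cmul0l ?cmul0r ?subrr // normr0.
have bK x y : K x -> K y -> `|x - y| < 2.
  move=> [_ /= nx] [_ /= ny]; apply: le_lt_trans (ler_normB _ _) _.
  apply: le_lt_trans (lerD nx ny) _.
  by rewrite -[2^-1]mul1r -splitr ltr1n.
have [g [[/= /subr0_eq gs /subr0_eq gh] _] fg] :=
  half_contraction_fixpoint clK K0 fK fc bK.
exists g; split => //.
by rewrite [in RHS]fg scalerA divff ?scale1r // pnatr_eq0.
Qed.

(** With g as above, u = h + i (1 - g) is a unitary of the unitization, and
w = h - i g is u - i. The relation star w w = i (w - star w) expresses that u
is unitary without using the unit; it is preserved by phi, and taking norms gives
|w|^2 <= 2 |w| for the image w. *)
Lemma star_hom_selfadjoint_bound C D (phi : C -> D) (h : C) : star_hom phi ->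
  star h = h -> `|h| <= 2^-1 -> `|phi h| <= 2.
Proof.
move=> hphi sh nh; have [g [gs gh hg]] := selfadjoint_square_root sh nh.
pose w := phi h - 'i *: phi g.
have sw : star w = phi h + 'i *: phi g.
  rewrite /w starB starZ -!(star_homS hphi) sh gs conjCi.
  by rewrite scaleNr opprK.
have eb : 2 *: phi g = 'i *: (w - star w).
  rewrite sw /w opprD addrACA subrr add0r scalerDr !scalerN !scalerA -expr2.
  by rewrite sqrCi !scaleN1r !opprK scaler_nat mulr2n.
have ww : star w ** w = 'i *: (w - star w).
  rewrite -eb -(star_homZ hphi) -hg (star_homD hphi) !(star_homM hphi) sw /w.
  rewrite cmulDl !cmulBr !cmulZl !cmulZr -!(star_homM hphi) gh addrA subrK.
  by rewrite scalerA -expr2 sqrCi scaleN1r opprK.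
have nw : `|w| <= 2.
  have [->|w0] := eqVneq w 0; first by rewrite normr0.
  have pw : 0 < `|w| by rewrite normr_gt0.
  rewrite -(ler_pM2r pw) -expr2 -cstar_identity ww normrZ normCi mul1r.
  apply: le_trans (ler_normB _ _) _.
  by rewrite norm_star mulr_natl.
have -> : phi h = 2^-1 *: (w + star w).
  rewrite sw /w addrACA addNr addr0 scalerDr -scalerDl -[2^-1]mul1r -splitr.
  by rewrite scale1r.
rewrite normrZ ger0_norm ?invr_ge0 // mulrC ler_pdivrMr //.
apply: le_trans (ler_normD _ _) _.
by rewrite norm_star mulr_natl mulr2n lerD.
Qed.

(** The constant is not optimal: the two halves of 2 x = (x + star x) + (x - star x)
are selfadjoint up to the factor i, and each is rescaled to norm 1/2. *)
Lemma star_hom_bounded C D (phi : C -> D) (x : C) : star_hom phi ->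
  `|phi x| <= 8 * `|x|.
Proof.
move=> hphi.
have sa (h : C) : star h = h -> `|phi h| <= 4 * `|h|.
  have [-> _|h0 sh] := eqVneq h 0.
    by rewrite (star_hom0 hphi) !normr0 mulr0.
  have c0 : 0 < 2 * `|h| by rewrite mulr_gt0 // normr_gt0.
  have ci : 0 <= (2 * `|h|)^-1 by rewrite invr_ge0 ltW.
  have := @star_hom_selfadjoint_bound C D phi ((2 * `|h|)^-1 *: h) hphi.
  rewrite starZ sh geC0_conj // (star_homZ hphi) !normrZ.
  rewrite ger0_norm // invfM -mulrA mulVf ?normr_eq0 // mulr1.
  move=> /(_ erefl (lexx _)); rewrite -invfM mulrC ler_pdivrMr //.
  by rewrite mulrA -natrM.
have two : (2 : R[i]) *: x = (x + star x) + (x - star x).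
  by rewrite addrACA subrr addr0 scaler_nat mulr2n.
have n1 : `|phi (x + star x)| <= 8 * `|x|.
  apply: le_trans (sa _ _) _; first by rewrite starD starK addrC.
  rewrite (natrM _ 4 2) -mulrA ler_wpM2l //.
  by apply: le_trans (ler_normD _ _) _; rewrite norm_star mulr_natl.
have n2 : `|phi (x - star x)| <= 8 * `|x|.
  rewrite -[leLHS]mul1r -normCi -normrZ -(star_homZ hphi).
  apply: le_trans (sa _ _) _.
    by rewrite starZ conjCi scaleNr -scalerN starB starK opprB.
  rewrite normrZ normCi mul1r (natrM _ 4 2) -mulrA ler_wpM2l //.
  by apply: le_trans (ler_normB _ _) _; rewrite norm_star mulr_natl.
rewrite -(@ler_pM2l _ 2) // -[in leLHS](@ger0_norm _ 2) // -normrZ.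
rewrite -(star_homZ hphi) two (star_homD hphi) (le_trans (ler_normD _ _)) //.
by rewrite mulr_natl mulr2n lerD.
Qed.

Lemma star_hom_kernel_closed C D (phi : C -> D) : star_hom phi ->
  closed [set x | phi x = 0].
Proof.
move=> hphi; apply: (@bounded_kernel_closed _ C D phi 8) => //.
  exact: star_homB.
by move=> x; exact: star_hom_bounded.
Qed.

End CStarBasics.

(** * Quotients, units and finite joins *)

Section Quotients.
Variable R : realType.
Implicit Types C D Q : cstarType R.

Lemma kernel_closed_ideal C D (phi : C -> D) : star_hom phi ->
  closed_ideal [set x | phi x = 0].
Proof.
move=> hphi; split => [|a x y /= x0 y0|x y /= x0|]; first exact: star_hom0.
- by case: hphi => -> _ _; rewrite x0 y0 scaler0 addr0.
- by rewrite !(star_homM hphi) x0 cmul0l cmul0r.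
- exact: star_hom_kernel_closed.
Qed.

(** This is where continuity of star-homomorphisms enters: the quotient is by the
smallest closed ideal, so the kernel of phi0 has to be closed. *)
Lemma quotient_factor C Q D (rels : set C) (pi : C -> Q) (phi0 : C -> D) :
    cstar_quotient rels pi -> star_hom phi0 ->
    (forall x, rels x -> phi0 x = 0) ->
  exists2 phi : Q -> D, star_hom phi & forall x, phi (pi x) = phi0 x.
Proof.
move=> [hpi surj ker] hphi0 rels0.
have ker0 x : pi x = 0 -> phi0 x = 0.
  move=> /ker /(_ [set z | phi0 z = 0]); apply; split; last exact: rels0.
  exact: kernel_closed_ideal.
have preim y : exists x, pi x = y.
  by have : [set: Q] y by []; rewrite -surj => -[x _ <-]; exists x.
pose lift y := projT1 (cid (preim y)).
have liftK y : pi (lift y) = y by rewrite /lift; case: cid.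
have E x : phi0 (lift (pi x)) = phi0 x.
  apply/eqP; rewrite -subr_eq0 -(star_homB hphi0); apply/eqP/ker0.
  by rewrite (star_homB hpi) liftK subrr.
exists (phi0 \o lift) => //; split.
- move=> a x y /=; rewrite -[x in LHS]liftK -[y in LHS]liftK.
  rewrite -(star_homZ hpi) -(star_homD hpi) E.
  by rewrite (star_homD hphi0) (star_homZ hphi0).
- move=> x y /=; rewrite -[x in LHS]liftK -[y in LHS]liftK.
  by rewrite -(star_homM hpi) E (star_homM hphi0).
- by move=> x /=; rewrite -[x in LHS]liftK -(star_homS hpi) E (star_homS hphi0).
Qed.

Lemma is_one_unique D (u w : D) : is_one u -> is_one w -> u = w.
Proof. by move=> /(_ w)[+ _] /(_ u)[_ +] => + <-. Qed.

Lemma is_one_surjective C D (phi : C -> D) (u : C) :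
  star_hom phi -> range phi = setT -> is_one u -> is_one (phi u).
Proof.
move=> hphi surj u1 y; have : [set: D] y by [].
by rewrite -surj => -[x _ <-]; rewrite -!(star_homM hphi) (u1 _).1 (u1 _).2.
Qed.

Lemma star_one D (u : D) : is_one u -> star u = u.
Proof.
move=> u1; apply: is_one_unique (u1) => x.
by rewrite -[x]starK -!starM (u1 _).1 (u1 _).2.
Qed.

Lemma star_hom_comp C D (E : cstarType R) (phi : C -> D) (psi : D -> E) :
  star_hom phi -> star_hom psi -> star_hom (psi \o phi).
Proof.
move=> hphi hpsi; split => [a x y|x y|x] /=.
- by rewrite (star_homD hphi) (star_homZ hphi) (star_homD hpsi) (star_homZ hpsi).
- by rewrite (star_homM hphi) (star_homM hpsi).
- by rewrite (star_homS hphi) (star_homS hpsi).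
Qed.

End Quotients.

Section Joins.
Variables (R : realType) (D : cstarType R) (one : D).
Hypothesis one1 : is_one one.
Variables (I : eqType) (f : I -> D).

Lemma compl_join (l : seq I) :
  one - \big[@cjoin R D/0]_(i <- l) f i = \big[*%g/one]_(i <- l) (one - f i).
Proof.
elim: l => [|i l ih]; first by rewrite !big_nil subr0.
rewrite !big_cons -ih /cjoin cmulBl (one1 _).1 cmulBr (one1 _).2.
by rewrite !opprD !opprK !addrA [_ - _ - f i]addrAC.
Qed.

(** With [compl_prod_absorbed] this compares products over different lists of
commuting idempotents: if each 1 - f i fixes w, and the product over l is 0,
then w = 0. No reordering of the products is needed. *)
Lemma compl_prod_absorb (l : seq I) (w : D) :
  {in l, forall i, (one - f i) ** w = w} ->
  (\big[*%g/one]_(i <- l) (one - f i)) ** w = w.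
Proof.
elim: l => [|i l ih] h; first by rewrite big_nil (one1 _).1.
rewrite big_cons -mulgA ih ?h ?inE ?eqxx // => j jl.
by apply: h; rewrite inE jl orbT.
Qed.

Lemma compl_prod_absorbed (l : seq I) (i : I) :
    {in l, forall j, f j ** f j = f j} ->
    {in l &, forall j k, f j ** f k = f k ** f j} ->
    i \in l ->
  (one - f i) ** (\big[*%g/one]_(j <- l) (one - f j)) =
  \big[*%g/one]_(j <- l) (one - f j).
Proof.
elim: l => //= j l ih idem comm il; rewrite big_cons.
have [ij|ji] := eqVneq i j.
  rewrite ij mulgA (_ : _ ** (one - f j) = one - f j) //.
  by rewrite cmulBr (one1 _).2 cmulBl (one1 _).1 idem ?inE ?eqxx // subrr subr0.
have il' : i \in l by move: il; rewrite inE (negPf ji).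
rewrite mulgA (_ : _ ** (one - f j) = (one - f j) ** (one - f i)).
  rewrite -mulgA ih // => [k kl|k m kl ml].
    by rewrite idem // inE kl orbT.
  by rewrite comm // inE ?kl ?ml orbT.
rewrite !cmulBl !cmulBr !(one1 _).1 !(one1 _).2 comm ?inE ?eqxx ?il' ?orbT //.
by rewrite !opprD !opprK !addrA [_ - _ - f j]addrAC.
Qed.

Lemma join_le (p : D) (l : seq I) : {in l, forall i, p ** f i = f i} ->
  p ** \big[@cjoin R D/0]_(i <- l) f i = \big[@cjoin R D/0]_(i <- l) f i.
Proof.
elim: l => [|i l ih] h; first by rewrite big_nil cmul0r.
rewrite big_cons /cjoin cmulBr cmulDr mulgA h ?inE ?eqxx // ih // => j jl.
by rewrite h // inE jl orbT.
Qed.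

End Joins.

Lemma fjoin1 (R : realType) (S : inverseSemigroup0Type) (D : cstarType R)
  (sigma : S -> D) (s : S) : fjoin sigma [fset s]%fset = sigma s.
Proof.
by rewrite /fjoin -fset_seq1 big_cons big_nil /cjoin cmul0r subr0 addr0.
Qed.

(** * Multiplication in the left inverse hull *)

Section Hull.
Variables (P : monoidType) (hP : right_LCM [set: P]).
Local Notation S := (left_inverse_hull hP).
Local Notation elt p q := (hull_elt hP p q).
Local Open Scope group_scope.

Lemma rideal_refl (M : set P) (p : P) : M 1 -> rideal M p p.
Proof. by exists 1; rewrite ?mulg1. Qed.

Lemma rideal1 : rideal [set: P] 1 = setT.
Proof. by apply/seteqP; split => // x _; exists x; rewrite ?mul1g. Qed.

Lemma rideal_inj (p q : P) : rideal setT p = rideal setT q ->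
  exists2 u, invertible u & p = q * u.
Proof.
move=> E.
have : rideal setT q p by rewrite -E; exact: rideal_refl.
move=> [u _ pu]; have : rideal setT p q by rewrite E; exact: rideal_refl.
move=> [w _ qw]; exists u => //; exists w; split.
  by apply: (hP.1 q) => //; rewrite mulgA pu qw mulg1.
by apply: (hP.1 p) => //; rewrite mulgA qw pu mulg1.
Qed.

Lemma hull_elt_unit (p q u : P) : invertible u -> elt (p * u) (q * u) = elt p q.
Proof. by move=> hu; congr Some; apply/hull_pairP; exists u. Qed.

Lemma hull_idem_eq (p q : P) : rideal setT p = rideal setT q ->
  elt p p = elt q q.
Proof. by move=> /rideal_inj[u hu ->]; exact: hull_elt_unit. Qed.

Lemma hull_eltP (s : S) : s = szero \/ exists p q, s = elt p q.
Proof.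
case: s => [c|]; [right|by left].
by exists (repr c).1, (repr c).2; rewrite /hull_elt hull_reprK.
Qed.

Lemma hull_eltM (a b c d b' c' : P) :
    rideal setT b `&` rideal setT c = rideal setT (b * b') -> b * b' = c * c' ->
  elt a b * elt c d = elt (a * b') (d * c').
Proof. move=> E e; exact: (@hull_mulE _ hP a b c d (b', c')). Qed.

Lemma hull_eltM0 (a b c d : P) : rideal setT b `&` rideal setT c = set0 ->
  elt a b * elt c d = szero.
Proof. exact: hull_mul0. Qed.

Lemma hull_eltM_cancel (a b d : P) : elt a b * elt b d = elt a d.
Proof.
by rewrite (@hull_eltM _ _ _ _ 1 1) ?mulg1 // setIid.
Qed.

Lemma hull_eltM1 (p q r : P) : elt p 1 * elt q r = elt (p * q) r.
Proof.
by rewrite (@hull_eltM _ _ _ _ q 1) ?mulg1 ?mul1g // rideal1 setTI.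
Qed.

Lemma hull_elt1M (q r p : P) : elt q r * elt 1 p = elt q (p * r).
Proof.
by rewrite (@hull_eltM _ _ _ _ 1 r) ?mulg1 ?mul1g // rideal1 setIT.
Qed.

Lemma hull_mul1s (s : S) : elt 1 1 * s = s.
Proof.
have [->|[p [q ->]]] := hull_eltP s; first exact: smuls0.
by rewrite hull_eltM1 mul1g.
Qed.

Lemma hull_muls1 (s : S) : s * elt 1 1 = s.
Proof.
have [->|[p [q ->]]] := hull_eltP s; first exact: smul0s.
by rewrite hull_elt1M mul1g.
Qed.

Lemma hull_idemM (p q r : P) :
    rideal setT p `&` rideal setT q = rideal setT r ->
  elt p p * elt q q = elt r r.
Proof.
move=> E; have : rideal setT r r by exact: rideal_refl.
rewrite -E => -[[p' _ ep] [q' _ eq]].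
by rewrite (@hull_eltM _ _ _ _ p' q') ?ep ?eq.
Qed.

Lemma hull_elt_inv (p q : P) : sinv (elt p q) = elt q p.
Proof. exact: hull_invE. Qed.

Lemma hull_elt_idem (p : P) : elt p p * elt p p = elt p p.
Proof. exact: hull_eltM_cancel. Qed.

(** Ideals in the semigroup algebra are subsets of P, whereas an idempotent of the
hull is named by a generator; all generators of the same ideal give the same
idempotent, by [hull_idem_eq]. *)
Definition ideal_idem (X : constructible_ideal P) : S :=
  if pselect (exists p, sval X = rideal setT p) is left h
  then elt (projT1 (cid h)) (projT1 (cid h)) else szero.

Lemma ideal_idemE (X : constructible_ideal P) (p : P) :
  sval X = rideal setT p -> ideal_idem X = elt p p.
Proof.
move=> E; rewrite /ideal_idem; case: pselect => [h|[]]; last by exists p.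
by apply: hull_idem_eq; rewrite -E; case: cid.
Qed.

Lemma ideal_idem0 (X : constructible_ideal P) :
  sval X = set0 -> ideal_idem X = szero.
Proof.
move=> E; rewrite /ideal_idem; case: pselect => // -[p].
rewrite E => h; have : rideal setT p p by exact: rideal_refl.
by rewrite -h.
Qed.

Lemma constructible_idealP (X : constructible_ideal P) :
  sval X = set0 \/ exists p, sval X = rideal setT p.
Proof. by case: (proj2_sig X) => [->|[p _ ->]]; [left|right; exists p]. Qed.

End Hull.

Arguments ideal_idem {P} hP X.

(** * From isometries to representations of the hull *)

Section FromSemigroup.
Variables (R : realType) (P : monoidType) (hP : right_LCM [set: P]).
Variables (D : cstarType R) (v : P -> D) (e : constructible_ideal P -> D).
Local Notation S := (left_inverse_hull hP).
Local Notation elt p q := (hull_elt hP p q).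

(** The value on the class [p, q] is v_p star(v_q) for the chosen representative;
[hull_mapE] shows that any other one gives the same value. *)
Definition hull_map (s : S) : D :=
  if s is Some c then v (repr c).1 ** star (v (repr c).2) else 0.

Hypothesis rel : lcm_relations v e.
Variable one : D.
Hypothesis one1 : is_one one.

Lemma lcm_isometry p : star (v p) ** v p = one.
Proof. by case: rel => o o1 [+ _ _ _ _]; rewrite (is_one_unique one1 o1). Qed.

Let vM p q : v p ** v q = v (p * q)%g.
Proof. by case: rel => o o1 []. Qed.

Lemma lcm_translate p X Y : sval Y = [set (p * x)%g | x in sval X] ->
  v p ** e X ** star (v p) = e Y.
Proof. by case: rel => o o1 [_ _ _ + _]; apply. Qed.

Lemma idealT_one X : sval X = setT -> e X = one.
Proof.
by case: rel => o o1 [_ _ _ _ [+ _ _]]; rewrite (is_one_unique one1 o1); apply.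
Qed.

Lemma ideal0_zero X : sval X = set0 -> e X = 0.
Proof. by case: rel => o o1 [_ _ _ _ [_ + _]]; apply. Qed.

Let eM X Y Z : sval Z = sval X `&` sval Y -> e X ** e Y = e Z.
Proof. by case: rel => o o1 [_ _ _ _ [_ _]]; apply. Qed.

Lemma ideal_idempotent X : e X ** e X = e X.
Proof. by apply: eM; rewrite setIid. Qed.

Lemma ideal_comm X Y : e X ** e Y = e Y ** e X.
Proof.
have [Z EZ] : exists Z : constructible_ideal P, sval Z = sval X `&` sval Y.
  have [XI YI] := (proj2_sig X, proj2_sig Y).
  suff h : principal_ideals setT (sval X `&` sval Y) by exists (exist _ _ h).
  case: XI => [->|[p _ ->]]; first by rewrite set0I; left.
  case: YI => [->|[q _ ->]]; first by rewrite setI0; left.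
  exact: hP.2.
by rewrite (eM EZ) (@eM Y X Z) // setIC.
Qed.

Lemma range_projection p X : sval X = rideal setT p -> v p ** star (v p) = e X.
Proof.
move=> E; rewrite -(@lcm_translate p (pideal 1%g)) ?idealT_one ?(one1 _).2 //=.
  exact: rideal1.
by rewrite E rideal1.
Qed.

Lemma isometry_one : v 1%g = one.
Proof.
by rewrite -[LHS](one1 _).1 -{1}(lcm_isometry 1%g) -mulgA vM mulg1 lcm_isometry.
Qed.

(** Two representatives differ by an invertible u, and v_u is unitary because its
range projection is that of uP = P. *)
Lemma hull_mapE p q : hull_map (elt p q) = v p ** star (v q).
Proof.
rewrite /hull_map /hull_elt.
have := hull_reprK (hull_pair p q); case: (repr _) => a b /=.
move=> /hull_pairP[u [[w [uw wu]] -> ->]].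
rewrite -!vM starM mulgA -(mulgA (v p)) (@range_projection u (pideal 1%g)).
  by rewrite idealT_one ?(one1 _).2 //; exact: rideal1.
rewrite /= rideal1; apply/seteqP; split => // x _.
by exists (w * x)%g; rewrite // mulgA uw mul1g.
Qed.

Lemma hull_map_idem p : hull_map (elt p p) = e (pideal p).
Proof. by rewrite hull_mapE; exact: range_projection. Qed.

Let vSl p : star (v p) ** e (pideal p) = star (v p).
Proof. by rewrite -(@range_projection p) // mulgA lcm_isometry (one1 _).1. Qed.

Let ve p : e (pideal p) ** v p = v p.
Proof. by rewrite -(@range_projection p) // -mulgA lcm_isometry (one1 _).2. Qed.

(** The key is the value of star(v_b) v_c. Inserting the range projections of v_b
and v_c turns it into star(v_b) e v_c, where e is the projection of the
intersection of bP and cP: this is 0 if the intersection is empty, and if it is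
rP with r = b b' = c c', then e = v_r star(v_r) leaves v_b' star(v_c'). *)
Lemma hull_map_rep : representation hull_map.
Proof.
split => // [s t|s].
- have [->|[a [b ->]]] := hull_eltP s; first by rewrite smul0s cmul0l.
  have [->|[c [d ->]]] := hull_eltP t; first by rewrite smuls0 cmul0r.
  have bc : star (v b) ** v c = star (v b) ** (e (pideal b) ** e (pideal c)) ** v c.
    by rewrite mulgA vSl -mulgA ve.
  have [E|[r _ E]] := hP.2 b c I I.
    rewrite hull_eltM0 // !hull_mapE mulgA -(mulgA (v a)) bc.
    rewrite (@eM _ _ (exist _ set0 (or_introl erefl))) /= ?E //.
    by rewrite (@ideal0_zero (exist _ set0 _)) // cmul0r cmul0l cmul0r cmul0l.
  have : rideal setT r r by exact: rideal_refl.
  rewrite -E => -[[b' _ eb] [c' _ ec]].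
  rewrite (@hull_eltM _ _ _ _ _ _ b' c') ?eb ?ec // !hull_mapE.
  rewrite mulgA -(mulgA (v a)) bc (@eM _ _ (pideal r)) //=.
  rewrite -(@range_projection r) // -{1}eb -ec -!vM !starM.
  have vK p x : star (v p) ** (v p ** x) = x by rewrite mulgA lcm_isometry (one1 _).1.
  by rewrite -!mulgA !vK.
- have [->|[p [q ->]]] := hull_eltP s; first by rewrite star0.
  by rewrite hull_elt_inv !hull_mapE starM starK.
Qed.

Lemma unital_rep_proper (sigma : S -> D) :
  sigma (elt 1%g 1%g) = one -> proper_rep sigma.
Proof.
move=> s1 b _; exists [fset elt 1%g 1%g]%fset.
  by move=> x /=; rewrite inE => /eqP ->; exact: hull_elt_idem.
by rewrite /cle fjoin1 s1 (one1 _).2.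
Qed.

End FromSemigroup.

Section Covers.
Variables (R : realType) (P : monoidType) (hP : right_LCM [set: P]).
Variables (D : cstarType R) (v : P -> D) (e : constructible_ideal P -> D).
Hypothesis rel : lcm_relations v e.
Variable one : D.
Hypothesis one1 : is_one one.
Variable M : set P.
Local Notation elt p q := (hull_elt hP p q).
Local Notation sigma := (@hull_map _ _ hP _ v).

Lemma hull_map_X_A : subsemigroup M -> (forall a, M a -> e (pideal a) = one) ->
  forall x F, X_A hP M (x, F) -> sigma x = fjoin sigma F.
Proof.
move=> MM e1 x F [a [b [Ma [c Mc <-] [-> ->]]]].
rewrite fjoin1 !(hull_map_idem _ rel one1) !e1 //; exact: MM.
Qed.

(** Dividing a cover of sM by s gives a foundation set H of M. Let Q be the product
of the 1 - e_f over the cover. Since e_t star(v_s) = star(v_s) e_(st), every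
1 - e_t with t in H fixes star(v_s) Q; the product of these factors is 0, so
star(v_s) Q = 0 and hence e_s Q = 0. As Q is the complement of the join, e_s is
below the join; conversely each e_f is below e_s. *)
Lemma hull_map_X_U :
    (forall F : {fset P}, foundation_set M F ->
       \big[*%g/one]_(f <- F) (one - e (pideal f)) = 0) ->
  forall x F, X_U hP M (x, F) -> sigma x = fjoin sigma F.
Proof.
move=> e0 x _ [s [F [Ms Fs cov [-> ->]]]].
set G := [fset elt f f | f in F]%fset.
have GP y : y \in G -> exists2 f, f \in F & y = elt f f.
  by move=> /imfsetP[f fF ->]; exists f.
have sigE p : sigma (elt p p) = e (pideal p) by exact: (hull_map_idem hP rel one1).
have [sig0 sigM sigS] := hull_map_rep hP rel one1.
pose Q := \big[*%g/one]_(y <- G) (one - sigma y).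
have QE : one - fjoin sigma G = Q by exact: compl_join.
have Qabs f : f \in F -> (one - e (pideal f)) ** Q = Q.
  move=> fF; rewrite -sigE; apply: compl_prod_absorbed => //.
  - by move=> y /GP[g _ ->]; rewrite sigE (ideal_idempotent rel).
  - by move=> y z /GP[g _ ->] /GP[k _ ->]; rewrite !sigE (ideal_comm hP rel).
  - by apply/imfsetP; exists f.
pose q f := xget 1%g [set t | M t /\ f = (s * t)%g].
have qP f : f \in F -> M (q f) /\ f = (s * q f)%g.
  by move=> /Fs[t Mt tf]; rewrite /q; case: xgetP => // /(_ t)[].
pose H := [fset q f | f in F]%fset.
have Hfound : foundation_set M H.
  split => [_ /imfsetP[f /qP[Mq _] ->] //|t Mt].
  have [|f fF [y [[m Mm em] [n Mn en]]]] := cov (s * t)%g; first by exists t.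
  have [_ fE] := qP _ fF; exists (q f); first by apply/imfsetP; exists f.
  exists (t * n)%g; split; [exists m => //|by exists n].
  by apply: (hP.1 s) => //; rewrite !mulgA -fE em en.
have shift t : e (pideal t) ** star (v s) = star (v s) ** e (pideal (s * t)%g).
  rewrite -(lcm_translate rel (p := s) (X := pideal t) (Y := pideal (s * t)%g)) /=.
    by rewrite !mulgA (lcm_isometry rel one1) (one1 _).1.
  apply/seteqP; split => [_ [m _ <-]|_ [_ [m _ <-] <-]].
    by exists (t * m)%g; [exists m|rewrite mulgA].
  by exists m; rewrite // mulgA.
have w0 : star (v s) ** Q = 0.
  rewrite -(@compl_prod_absorb _ _ _ one1 _ (e \o @pideal P) H (star (v s) ** Q)).
    by rewrite e0 // cmul0l.
  move=> _ /imfsetP[f fF ->] /=; have [_ fE] := qP _ fF.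
  by rewrite mulgA cmulBl (one1 _).1 shift -fE -{1}[star _](one1 _).2 -cmulBr
    -mulgA Qabs.
have sQ : sigma (elt s s) ** Q = 0.
  by rewrite (hull_mapE hP rel one1) -mulgA w0 cmul0r.
apply/eqP; rewrite -subr_eq0 -sQ -QE cmulBr (one1 _).2 /fjoin join_le // => y.
move=> /GP[f fF ->]; rewrite -sigM; have [_ ->] := qP _ fF.
rewrite (@hull_idemM _ _ _ _ (s * q f)%g) //; apply/setIidPr.
by move=> _ [m _ <-]; exists (q f * m)%g; rewrite // mulgA.
Qed.
End Covers.

(** * From representations of the hull to isometries *)

Section FromHull.
Variables (R : realType) (P : monoidType) (hP : right_LCM [set: P]).
Local Notation S := (left_inverse_hull hP).
Local Notation elt p q := (hull_elt hP p q).
Local Notation J := (constructible_ideal P).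

Definition generators_map (D : cstarType R) (sigma : S -> D) (x : P + J) : D :=
  match x with
  | inl p => sigma (elt p 1%g)
  | inr X => sigma (ideal_idem hP X)
  end.

(** The elements on which [1, 1] acts as an identity form a C*-subalgebra, which
contains the generators. *)
Lemma hull_rep_unital (D : cstarType R) (sigma : S -> D) :
    representation sigma -> cstar_generated (range sigma) = setT ->
  is_one (sigma (elt 1%g 1%g)).
Proof.
move=> [sig0 sigM sigS] gen; set u := sigma _.
pose K := [set x | u ** x - x = 0] `&` [set x | x ** u - x = 0].
have KE x : K x <-> u ** x = x /\ x ** u = x.
  by split => [[/= /subr0_eq ? /subr0_eq ?]|[e1 e2]] //; split;
    rewrite /= ?e1 ?e2 subrr.
have su : star u = u by rewrite -sigS hull_elt_inv.
have subK : cstar_subalgebra K.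
  split.
  - by apply/KE; rewrite cmul0r cmul0l.
  - move=> a x y /KE[x1 x2] /KE[y1 y2]; apply/KE.
    by rewrite cmulDr cmulDl cmulZr cmulZl x1 x2 y1 y2.
  - move=> x y /KE[x1 x2] /KE[y1 y2]; apply/KE.
    by rewrite mulgA x1 -mulgA y2.
  - by move=> x /KE[x1 x2]; apply/KE; rewrite -su -!starM x1 x2.
  - have pos : 0 < `|u| + 1 by rewrite ltr_wpDl.
    apply: closedI.
      apply: (@bounded_kernel_closed _ D D (fun x => u ** x - x) (`|u| + 1)) => //.
        by move=> x y; rewrite cmulBr !opprD !opprK addrACA.
      move=> x; apply: le_trans (ler_normB _ _) _.
      by rewrite mulrDl mul1r lerD // cnormM.
    apply: (@bounded_kernel_closed _ D D (fun x => x ** u - x) (`|u| + 1)) => //.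
      by move=> x y; rewrite cmulBl !opprD !opprK addrACA.
    move=> x; apply: le_trans (ler_normB _ _) _.
    by rewrite mulrDl mul1r lerD // mulrC cnormM.
move=> x; apply/KE; have : [set: D] x by [].
rewrite -gen; apply; split => // _ [s _ <-]; apply/KE.
by rewrite -!sigM hull_mul1s hull_muls1.
Qed.

Section Relations.
Variables (D : cstarType R) (sigma : S -> D).
Hypothesis rep : representation sigma.
Local Notation one := (sigma (elt 1%g 1%g)).
Hypothesis one1 : is_one one.
Local Notation e := (generators_map sigma \o inr).

Lemma generators_map_pideal p : e (pideal p) = sigma (elt p p).
Proof. by rewrite /= (@ideal_idemE _ hP (pideal p) p). Qed.

(** Every relation is the image under sigma of an identity between elements of the
hull: a translate of an ideal corresponds to conjugation by [p, 1], and an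
intersection of ideals to a product of idempotents. *)
Lemma generators_map_relations : lcm_relations (generators_map sigma \o inl) e.
Proof.
have [sig0 sigM sigS] := rep.
have idemP X : ideal_idem hP X = szero \/ exists p, ideal_idem hP X = elt p p.
  have [X0|[p E]] := constructible_idealP X; first by left; exact: ideal_idem0.
  by right; exists p; exact: ideal_idemE.
exists one => //; split; last split.
- by move=> p; rewrite /= -sigS -sigM hull_elt_inv hull_eltM_cancel.
- move=> X; rewrite /projection /= -sigS -sigM.
  have [->|[p ->]] := idemP X; last by rewrite hull_elt_inv hull_elt_idem.
  by rewrite smul0s !sig0.
- by move=> p q; rewrite /= -sigM hull_eltM1.
- move=> p X Y YX; rewrite /= -sigS -!sigM hull_elt_inv; congr sigma.
  have [X0|[q Xq]] := constructible_idealP X.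
    rewrite (ideal_idem0 _ X0) smuls0 smul0s ideal_idem0 // YX X0.
    by rewrite image_set0.
  rewrite (ideal_idemE _ Xq) (@ideal_idemE _ hP Y (p * q)%g).
    by rewrite hull_eltM1 hull_elt1M.
  rewrite YX Xq; apply/seteqP; split => [_ [_ [m _ <-] <-]|_ [m _ <-]].
    by exists m; rewrite // mulgA.
  by exists (q * m)%g; [exists m|rewrite mulgA].
- by move=> X XT; rewrite /= (@ideal_idemE _ hP X 1%g) // rideal1.
- by move=> X X0; rewrite /= ideal_idem0.
- move=> X Y Z E; rewrite /= -sigM; congr sigma.
  have [X0|[p Xp]] := constructible_idealP X.
    by rewrite (ideal_idem0 _ X0) smul0s ideal_idem0 // E X0 set0I.
  have [Y0|[q Yq]] := constructible_idealP Y.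
    by rewrite (ideal_idem0 _ Y0) smuls0 ideal_idem0 // E Y0 setI0.
  rewrite (ideal_idemE _ Xp) (ideal_idemE _ Yq).
  have [Z0|[r Zr]] := constructible_idealP Z.
    by rewrite (ideal_idem0 _ Z0) hull_eltM0 // -Xp -Yq -E.
  by rewrite (ideal_idemE _ Zr); apply: hull_idemM; rewrite -Xp -Yq -E.
Qed.

Variable M : set P.
Hypothesis M1 : M 1%g.

Lemma generators_map_additive :
    (forall x F, X_A hP M (x, F) -> sigma x = fjoin sigma F) ->
  forall x, additive_relators M e x -> x = 0.
Proof.
move=> cov x [w w1 [a Ma ->]]; rewrite (is_one_unique w1 one1).
rewrite generators_map_pideal (cov (elt 1%g 1%g) [fset elt a a]%fset).
  by rewrite fjoin1 subrr.
by exists 1%g, a; split => //; exists a; rewrite // mul1g.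
Qed.

(** A foundation set F of M covers the ideal of 1, so X_U makes 1 the join of the
[f, f]. The elements of F and the idempotents [f, f] are enumerated differently,
and associated generators give the same idempotent, so the two products of
complements are compared by absorption. *)
Lemma generators_map_multiplicative :
    (forall x F, X_U hP M (x, F) -> sigma x = fjoin sigma F) ->
  forall x, multiplicative_relators M e x -> x = 0.
Proof.
have [sig0 sigM sigS] := rep.
move=> cov x [w w1 [F [FM fnd] ->]]; rewrite (is_one_unique w1 one1).
pose G := [fset elt f f | f in F]%fset.
have G0 : \big[*%g/one]_(y <- G) (one - sigma y) = 0.
  rewrite -(compl_join one1 sigma) [X in X - _](cov _ G) ?subrr //.
  exists 1%g, F; split => //.
    by move=> f /FM Mf; exists f; rewrite // mul1g.
  by move=> _ [t Mt <-]; rewrite mul1g; exact: fnd.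
rewrite -[LHS](one1 _).1.
have <- := @compl_prod_absorb _ _ _ one1 _ sigma G
  (\big[*%g/one]_(f <- F) (one - e (pideal f))).
  by rewrite G0 cmul0l cmul0r.
move=> _ /imfsetP[f fF ->]; rewrite -(generators_map_pideal f).
apply: (@compl_prod_absorbed _ _ _ one1 _ (fun p => e (pideal p)) F f) => //.
  by move=> g _; rewrite generators_map_pideal -sigM hull_elt_idem.
move=> g h _ _; exact: (ideal_comm hP generators_map_relations).
Qed.

End Relations.
End FromHull.

Section Relators.
Variables (R : realType) (P : monoidType) (M : set P).
Variables (C D : cstarType R) (phi : C -> D) (one : C).
Variable e : constructible_ideal P -> C.
Hypotheses (hphi : star_hom phi) (one1 : is_one one) (phi1 : is_one (phi one)).

Lemma additive_relators_image :
  additive_relators M (phi \o e) = phi @` additive_relators M e.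
Proof.
apply/seteqP; split => [_ [w w1 [a Ma ->]]|_ [_ [w w1 [a Ma ->]] <-]].
  exists (e (pideal a) - one); first by exists one => //; exists a.
  by rewrite (star_homB hphi) (is_one_unique w1 phi1).
exists (phi one) => //; exists a => //.
by rewrite (star_homB hphi) (is_one_unique w1 one1).
Qed.

Lemma multiplicative_relators_image :
  multiplicative_relators M (phi \o e) = phi @` multiplicative_relators M e.
Proof.
have morph F : phi (\big[*%g/one]_(f <- F) (one - e (pideal f))) =
    \big[*%g/phi one]_(f <- F) (phi one - (phi \o e) (pideal f)).
  rewrite (big_morph phi (star_homM hphi) erefl).
  by apply: eq_bigr => f _; rewrite (star_homB hphi).
apply/seteqP; split => [_ [w w1 [F hF ->]]|_ [_ [w w1 [F hF ->]] <-]].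
  rewrite (is_one_unique w1 phi1) -morph.
  by eexists; last reflexivity; exists one => //; exists F.
rewrite (is_one_unique w1 one1) morph.
by exists (phi one) => //; exists F.
Qed.

End Relators.

(** * The two presentations define the same algebra *)

Section Isomorphism.
Variables (R : realType) (P : monoidType) (hP : right_LCM [set: P]).
Local Notation S := (left_inverse_hull hP).
Local Notation elt p q := (hull_elt hP p q).
Local Notation J := (constructible_ideal P).

Lemma lcm_relations_morph (C D : cstarType R) (phi : C -> D)
    (v : P -> C) (e : J -> C) : star_hom phi -> range phi = setT ->
  lcm_relations v e -> lcm_relations (phi \o v) (phi \o e).
Proof.
move=> hphi surj [one one1 [vSv eP vM vev [e1 e0 eM]]].
exists (phi one); first exact: is_one_surjective.
split; last split.
- by move=> p; rewrite /= -(star_homS hphi) -(star_homM hphi) vSv.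
- move=> X; have [es ee] := eP X.
  by split; rewrite /= -?(star_homS hphi) -?(star_homM hphi) ?es ?ee.
- by move=> p q; rewrite /= -(star_homM hphi) vM.
- move=> p X Y YX; rewrite /= -(star_homS hphi) -!(star_homM hphi).
  by rewrite (vev p X Y).
- by move=> X XT; rewrite /= e1.
- by move=> X X0; rewrite /= e0 // (star_hom0 hphi).
- by move=> X Y Z E; rewrite /= -(star_homM hphi) (eM X Y Z).
Qed.

Lemma star_hom_hull_map (C D : cstarType R) (phi : C -> D) (v : P -> C) :
  star_hom phi -> phi \o @hull_map R P hP C v = hull_map (hP := hP) (phi \o v).
Proof.
move=> hphi; apply/funext => -[c|] /=; last exact: star_hom0.
by rewrite (star_homM hphi) (star_homS hphi).
Qed.

Lemma star_hom_generators_map (C D : cstarType R) (phi : C -> D) (sigma : S -> C) :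
  phi \o generators_map sigma = generators_map (phi \o sigma).
Proof. by apply/funext => -[]. Qed.

Lemma hull_map_generators_map (D : cstarType R) (sigma : S -> D) :
  representation sigma -> hull_map (generators_map sigma \o inl) = sigma.
Proof.
move=> [sig0 sigM sigS]; apply/funext => -[c|] //=.
rewrite -sigS -sigM hull_elt_inv hull_eltM1 mulg1.
by rewrite /hull_elt hull_reprK.
Qed.

Lemma generators_map_hull_map (D : cstarType R) (h : P + J -> D) :
    lcm_relations (h \o inl) (h \o inr) ->
  generators_map (hull_map (hP := hP) (h \o inl)) = h.
Proof.
move=> rel; have [one one1 _] := rel; apply/funext => -[p|X]; rewrite /generators_map.
  rewrite (hull_mapE hP rel one1) (isometry_one rel one1).
  by rewrite (star_one one1) (one1 _).2.
have [X0|[p Xp]] := constructible_idealP X.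
  by rewrite ideal_idem0 //; exact/esym/(ideal0_zero rel).
rewrite (ideal_idemE _ Xp) (hull_mapE hP rel one1).
exact: (range_projection rel one1).
Qed.

(** The comparison for an arbitrary set of relators and an arbitrary set of covers.
The three hypotheses are naturality of the relators, and the two translations
between vanishing relators and join relations for corresponding families. Only
uniqueness in the universal properties is used to see that the two homomorphisms
are mutually inverse. *)
Theorem quotient_isomorphic_to_join
    (rels : forall D : cstarType R, (J -> D) -> set D) (X : set (S * {fset S})) :
    (forall (C D : cstarType R) (phi : C -> D) one e,
       star_hom phi -> is_one one -> is_one (phi one) ->
       rels D (phi \o e) = phi @` rels C e) ->
    (forall (D : cstarType R) v e (one : D),
       lcm_relations v e -> is_one one ->
       (forall x, rels D e x -> x = 0) ->
       forall x F, X (x, F) ->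
         hull_map (hP := hP) v x = fjoin (hull_map (hP := hP) v) F) ->
    (forall (D : cstarType R) (sigma : S -> D),
       representation sigma -> is_one (sigma (elt 1%g 1%g)) ->
       (forall x F, X (x, F) -> sigma x = fjoin sigma F) ->
       forall x, rels D (generators_map sigma \o inr) x -> x = 0) ->
  forall (C B1 B2 : cstarType R) (g : P + J -> C) (pi : C -> B1),
    is_cstar_semigroup g -> cstar_quotient (rels C (g \o inr)) pi ->
    is_to_join_algebra X B2 -> cstar_isomorphic B1 B2.
Proof.
move=> relsI relsX Xrels C B1 B2 g pi [relC genC univC] quot [sigma].
move=> [[rep prop cov] gen univ].
have [hpi surj ker] := quot; have [one one1 _] := relC.
have pi1 := is_one_surjective hpi surj one1.
have rel1 : lcm_relations ((pi \o g) \o inl) ((pi \o g) \o inr).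
  exact: (lcm_relations_morph hpi surj relC).
have hull1 : to_join X (hull_map (hP := hP) ((pi \o g) \o inl)).
  split; first exact: (hull_map_rep hP rel1 pi1).
    apply: (unital_rep_proper pi1).
    rewrite (hull_mapE hP rel1 pi1) (isometry_one rel1 pi1).
    by rewrite (star_one pi1) (pi1 _).2.
  apply: (relsX _ _ _ _ rel1 pi1) => x.
  have -> : (pi \o g) \o inr = pi \o (g \o inr) by [].
  rewrite (relsI _ _ _ _ _ hpi one1 pi1) => -[y ry <-].
  by apply/ker => K [_]; apply.
have [psi [[hpsi psiE] _]] := univ _ _ hull1.
have one2 := hull_rep_unital rep gen.
have rel2 := generators_map_relations rep one2.
have [phi0 [[hphi0 phi0E] _]] := univC _ _ rel2.
have phi0g : phi0 \o g = generators_map sigma by exact/funext.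
have phi01 : is_one (phi0 one).
  suff -> : phi0 one = sigma (elt 1%g 1%g) by [].
  have <- : g (inr (pideal 1%g)) = one.
    by apply: (idealT_one relC one1); exact: rideal1.
  by rewrite phi0E; exact: (generators_map_pideal sigma 1%g).
have [|phi hphi phiE] := quotient_factor quot hphi0.
  move=> x rx; apply: (Xrels _ _ rep one2 cov).
  rewrite -phi0g; have -> : (phi0 \o g) \o inr = phi0 \o (g \o inr) by [].
  rewrite (relsI _ _ _ _ _ hphi0 one1 phi01).
  by exists x.
have psiphi : (psi \o phi) \o pi = pi.
  have [rho [_ uniq]] := univC _ _ rel1.
  rewrite -(uniq ((psi \o phi) \o pi)) ?(uniq pi) //; split.
    by apply: star_hom_comp => //; exact: star_hom_comp.
  move=> x; rewrite -[RHS](congr1 (@^~ x) (generators_map_hull_map rel1)).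
  rewrite -(_ : psi \o sigma = hull_map (hP := hP) _); last exact/funext.
  by rewrite -star_hom_generators_map /= phiE phi0E.
have phipsi : phi \o psi = id.
  have tj : to_join X sigma by split.
  have [rho [_ uniq]] := univ _ _ tj.
  rewrite -(uniq (phi \o psi)) ?(uniq id) //; split.
    exact: star_hom_comp.
  move=> s; rewrite /= psiE.
  have := congr1 (@^~ s) (star_hom_hull_map ((pi \o g) \o inl) hphi) => /= ->.
  rewrite -[RHS](congr1 (@^~ s) (hull_map_generators_map rep)).
  by congr (hull_map _ s); apply/funext => p /=; rewrite phiE phi0E.
exists phi => //; exists psi => [y|s].
  have : [set: B1] y by [].
  by rewrite -surj => -[x _ <-]; exact: (congr1 (@^~ x) psiphi).
exact: (congr1 (@^~ s) phipsi).
Qed.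

End Isomorphism.

Theorem theorem7p6 (R : realType) (P : monoidType)
    (countable_P : countable [set: P])
    (lcm_P : right_LCM [set: P])
    (U A : set P)
    (P_UA : zappa_szep U A)
    (C1 : right_LCM U /\ right_LCM A)
    (C2 : forall X Y, principal_ideals A X -> principal_ideals A Y ->
      X `<=` Y \/ Y `<=` X)
    (C3 : forall a, A a -> set_bij U U (zs_act U A a)) :
  (forall B1 B2 : cstarType R,
     is_additive_boundary_quotient A B1 ->
     is_to_join_algebra (X_A lcm_P A) B2 ->
     cstar_isomorphic B1 B2) /\
  (forall B1 B2 : cstarType R,
     is_multiplicative_boundary_quotient U B1 ->
     is_to_join_algebra (X_U lcm_P U) B2 ->
     cstar_isomorphic B1 B2).
Proof.
have [UU AA UA _] := P_UA.
have [U1 A1] : (U `&` A) 1%g by rewrite UA.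
split=> B1 B2 [C [g [pi [semi quot]]]].
  apply: (quotient_isomorphic_to_join (rels := additive_relators A)) semi quot.
  - by move=> *; exact: additive_relators_image.
  - move=> D v e one rel one1 vanish; apply: (hull_map_X_A rel one1 AA).
    move=> a Aa; apply/subr0_eq/vanish; exists one => //; by exists a.
  - by move=> D sigma rep one1 cov; exact: generators_map_additive.
apply: (quotient_isomorphic_to_join (rels := multiplicative_relators U)) semi quot.
- by move=> *; exact: multiplicative_relators_image.
- move=> D v e one rel one1 vanish; apply: (hull_map_X_U rel one1).
  by move=> F hF; apply: vanish; exists one => //; exists F.
- by move=> D sigma rep one1 cov; exact: generators_map_multiplicative.
Qed.
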